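(* Let $X$ and $Y$ be Banach spaces, let $B:X\to Y$ be a bounded linear operator, and let $U\subseteq X$ be a quasi-complement of the null-space $\mathcal{N}(B)$. Then the restriction $A:=B|_U:U\to Y$ is injective and the range $\mathcal{R}(A)$ of $A$ is dense in the range $\mathcal{R}(B)$ of $B$.
   Context: For a linear operator $B$, $\mathcal{N}(B)$ denotes its null-space (kernel) and $\mathcal{R}(B)$ its range. A quasi-complement of a closed subspace $V$ of a Banach space $X$ is a closed subspace $U\subseteq X$ such that $U\cap V=\{0\}$ and $U+V$ is dense in $X$. *)

(* Defs.v *)
From HB Require Import structures.
From mathcomp Require Import all_boot all_order all_algebra.
From mathcomp Require Import all_classical all_reals topology normedtype.

Set Implicit Arguments.
Unset Strict Implicit.
Unset Printing Implicit Defensive.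

Import Order.TTheory GRing.Theory Num.Theory.
Import numFieldNormedType.Exports.

Local Open Scope classical_set_scope.
Local Open Scope ring_scope.

(* Not the library's [bounded_fun], which asks for a bounded image and is
   satisfied by no nonzero linear map. *)
Definition bounded_operator (K : numFieldType) (X Y : normedModType K)
    (B : {linear X -> Y}) : Prop :=
  exists M : K, forall x : X, `|B x| <= M * `|x|.

Definition null_space (K : numFieldType) (X Y : normedModType K)
    (B : {linear X -> Y}) : set X :=
  [set x | B x = 0].

Definition closed_subspace (K : numFieldType) (X : normedModType K)
    (U : set X) : Prop :=
  GRing.submod_closed [in U] /\ closed U.

(* [U] is a quasi-complement of [V]. The notion is intended for a closed
   subspace [V]; closedness of [V] is not part of the predicate. *)
Definition quasi_complement (K : numFieldType) (X : normedModType K)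
    (V U : set X) : Prop :=
  [/\ closed_subspace U,
      U `&` V = [set 0] &
      dense [set u + v | u in U & v in V]].

(* The library's [dense] only concerns density in a whole space. *)
Definition dense_in (T : topologicalType) (D E : set T) : Prop :=
  D `<=` E /\ E `<=` closure D.

(* Main.v *)
Require Import Defs.
From HB Require Import structures.
From mathcomp Require Import all_boot all_order all_algebra.
From mathcomp Require Import all_classical all_reals topology normedtype.

Set Implicit Arguments.
Unset Strict Implicit.
Unset Printing Implicit Defensive.

Import Order.TTheory GRing.Theory Num.Theory.
Import numFieldNormedType.Exports.

Local Open Scope classical_set_scope.
Local Open Scope ring_scope.

(** Two vectors of [U] with the same image under [B] differ by a vector of
    [U] that [B] kills, and [U] meets the null-space only in [0]; this gives
    injectivity ([linear_injective_on]).

    For density, [B] does not see the null-space component of a sum [u + v], so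
    [B] maps [U + N(B)] into [B(U)]. As [B] is continuous
    ([bounded_operator_continuous]), it maps the closure of [U + N(B)], which
    is all of [X], into the closure of [B(U)] ([range_sub_closure_image]). *)

(** The bound [M] need not be real when [X] is trivial, so the absolute value
    of [M] is used instead: [M * `|x|] dominates a norm, hence is nonnegative
    and equal to its own absolute value. *)
Lemma bounded_operator_continuous (K : numFieldType) (X Y : normedModType K)
    (B : {linear X -> Y}) : bounded_operator B -> continuous B.
Proof.
move=> [M BM]; apply/bounded_linear_continuous/bounded_funP => r.
exists (`|M| * r) => x xr.
have Mx0 : 0 <= M * `|x| by apply: le_trans (BM x); exact: normr_ge0.
apply: le_trans (BM x) _; rewrite -(ger0_norm Mx0) normrM normr_id.
by rewrite ler_wpM2l.
Qed.

Lemma linear_injective_on (K : numFieldType) (X Y : normedModType K)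
    (B : {linear X -> Y}) (U : set X) :
  GRing.submod_closed [in U] -> U `&` null_space B = [set 0] ->
  {in U &, injective B}.
Proof.
move=> /GRing.submod_closedB[_ subU] UN0 u v uU vU Buv.
have : (U `&` null_space B) (u - v).
  split; first by apply/set_mem/subU.
  by rewrite /null_space /= linearB Buv subrr.
by rewrite UN0 => /eqP; rewrite subr_eq0 => /eqP.
Qed.

Lemma range_sub_closure_image (K : numFieldType) (X Y : normedModType K)
    (B : {linear X -> Y}) (U : set X) :
  continuous B -> dense [set u + v | u in U & v in null_space B] ->
  range B `<=` closure (B @` U).
Proof.
move=> Bcont UNdense _ [x _ <-] W; rewrite nbhsE => -[O [oO OBx] OW].
have [w [/= OBw [u Uu [v Bv0 uvE]]]] :
    (B @^-1` O) `&` [set u + v | u in U & v in null_space B] !=set0.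
  apply: UNdense; first by exists x.
  by apply: open_comp => // z _; exact: Bcont.
exists (B u); split; first by exists u.
by apply: OW; move: OBw; rewrite -uvE linearD Bv0 addr0.
Qed.

(* [K] covers the real scalars [R : realType] as well as the complex ones
   [R[i]]. *)
Theorem theorem3 (K : numFieldType) (X Y : completeNormedModType K)
    (B : {linear X -> Y}) (U : set X)
    (bounded_B : bounded_operator B)
    (quasi_U : quasi_complement (null_space B) U) :
  let A : U -> Y := sigL U B in
  injective A /\ dense_in (range A) (range B).
Proof.
case: quasi_U => -[subU _] UN0 UNdense A.
have rangeA : range A = B @` U.
  apply/seteqP; split=> [_ [u _ <-]|_ [u Uu <-]].
    by exists (val u) => //; exact: set_valP.
  by exists (SigSub (mem_set Uu)).
split.
  move=> u v Auv; apply: val_inj.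
  by apply: (linear_injective_on subU UN0) => //; exact: valP.
split; first by move=> _ [u _ <-]; exists (val u).
rewrite rangeA; apply: range_sub_closure_image UNdense.
exact: bounded_operator_continuous.
Qed.
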